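(* Suppose the kernels $\gamma_{\delta_i}$, $i=1,2$, are nonnegative and symmetric, $\gamma_{\delta_i}(x,y)=\gamma_{\delta_i}(y,x)$, vanish for $|x-y|>\delta_i$, are of the rescaled form $\gamma_{\delta_i}(x,y)=\delta_i^{-3}\gamma_i((x-y)/\delta_i)$ with $\frac12\int_{-1}^1s^2\gamma_i(s)\,ds=\sigma_i>0$, and satisfy $$\sup_{x\in\Omega_i\cup\mathcal{I}_i}\int_{B_{\delta_i}(x)\cap(\Omega_i\cup\mathcal{I}_i)}\gamma_{\delta_i}(x,y)\,dy\lesssim\delta_i^{-2}.$$ Then there exist constants $C_1,C_2>0$, depending only on $\Omega$ and $\gamma_1,\gamma_2$, such that for all $v\in V^0=\{v\in L^2(\Omega_1\cup\Omega_2): v|_{\mathcal{I}_i^D}=0,\ i=1,2\}$, $$C_1\|v\|_{L^2(\Omega_1\cup\Omega_2)}\le\|v\|_\delta\le C_2\max\{\delta_1^{-1},\delta_2^{-1}\}\|v\|_{L^2(\Omega_1\cup\Omega_2)}.$$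
   Context: Geometry. $\Omega=(a,b)$, $\alpha\in(a,b)$, $\Omega_1=(a,\alpha)$, $\Omega_2=(\alpha,b)$, $0<\delta_1\le\delta_2$; $\mathcal{I}_1^D=(a-\delta_1,a)$, $\mathcal{I}_2^D=(b,b+\delta_2)$, $\mathcal{I}_1^J=(\alpha,\alpha+\delta_1)$, $\mathcal{I}_2^J=(\alpha-\delta_2,\alpha)$, $\mathcal{I}_i=\mathcal{I}_i^D\cup\mathcal{I}_i^J$, $\Gamma=(\alpha-\delta_2,\alpha+\delta_1)$, $\Omega_2^J=(\alpha+\delta_1,\alpha+\delta_2)$. The horizons are such that $\mathcal{I}_2^J\subset\Omega_1$ and $\mathcal{I}_1^J\subset\Omega_2$. Kernels. $\gamma_i$ is nonnegative, even, locally integrable and compactly supported in $|s|<1$. $B_\delta(x)=\{y:|x-y|<\delta\}$; $\lesssim$ means up to a constant independent of $\delta_1,\delta_2$. Functions. Elements $v$ of $V^0$ are square-integrable functions on $\Omega_1\cup\Omega_2$ extended by zero to $\mathcal{I}_1^D\cup\mathcal{I}_2^D$; $v_i$ denotes $v$ on $\Omega_i\cup\mathcal{I}_i^D$, with the convention $v_1=v_2=v$ on $\Gamma$ (so $v_1=v$ also on $\mathcal{I}_1^J$ and $v_2=v$ also on $\mathcal{I}_2^J$). Norms. With $j=3-i$, $$\|v\|_{\delta_i}^2=\tfrac12\int_{\Omega_i\cup\mathcal{I}_i^D}\int_{\Omega_i\cup\mathcal{I}_i^D}[v_i(x)-v_i(y)]^2\gamma_{\delta_i}(x,y)\,dy\,dx,$$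 $$\|v\|_\Gamma^2=\tfrac12\sum_{i=1}^2\int_{\mathcal{I}_j^J}\int_{\mathcal{I}_i^J}[v_i(x)-v_i(y)]^2\gamma_{\delta_i}(x,y)\,dy\,dx+\int_{\mathcal{I}_2^J}\int_{\Omega_2^J}[v_2(x)-v_2(y)]^2\gamma_{\delta_2}(x,y)\,dy\,dx,$$ $\|v\|_\delta^2=\|v\|_{\delta_1}^2+\|v\|_{\delta_2}^2+\|v\|_\Gamma^2$. *)

(* Defs.v *)
From HB Require Import structures.
From mathcomp Require Import all_boot all_order all_algebra.
From mathcomp Require Import all_classical all_reals all_analysis.

Set Implicit Arguments.
Unset Strict Implicit.
Unset Printing Implicit Defensive.

Import Order.TTheory GRing.Theory Num.Theory.
Import numFieldNormedType.Exports.

Local Open Scope classical_set_scope.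
Local Open Scope ring_scope.

Section geometry.
Context {R : realType}.

(* Every set takes the whole tuple (a, b, alpha, d1, d2), where d1 and d2 are
   the horizons delta_1 and delta_2, even if it depends on part of it only. *)
Record config := Config
  { ca : R ; cb : R ; calpha : R ; cd1 : R ; cd2 : R }.
Implicit Type G : config.

Definition Omega1 G : set R := `]ca G, calpha G[.
Definition Omega2 G : set R := `]calpha G, cb G[.
Definition I1D G : set R := `]ca G - cd1 G, ca G[.
Definition I2D G : set R := `]cb G, cb G + cd2 G[.
Definition I1J G : set R := `]calpha G, calpha G + cd1 G[.
Definition I2J G : set R := `]calpha G - cd2 G, calpha G[.
Definition I1 G : set R := I1D G `|` I1J G.
Definition I2 G : set R := I2D G `|` I2J G.
Definition Omega2J G : set R := `]calpha G + cd1 G, calpha G + cd2 G[.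

Definition admissible G : Prop :=
  [/\ ca G < calpha G < cb G, 0 < cd1 G <= cd2 G,
      I2J G `<=` Omega1 G & I1J G `<=` Omega2 G].

End geometry.
Arguments config : clear implicits.

Section kernels.
Context {R : realType}.
Local Notation mu := (@lebesgue_measure R).

(* Vanishing is only required for |s| > 1, so that the indicator function of
   either the open or the closed interval is allowed. *)
Record kernel_profile (g : R -> R) : Prop := KernelProfile
  { profile_ge0 : forall s, 0 <= g s ;
    profile_even : forall s, g (- s) = g s ;
    profile_loc_int : locally_integrable setT g ;
    profile_support : forall s, 1 < `|s| -> g s = 0 }.

Definition half_second_moment (g : R -> R) : \bar R :=
  ((2^-1)%:E * \int[mu]_(s in `[(-1)%R, 1%R]) (s ^+ 2 * g s)%:E)%E.

Definition rescaled (g : R -> R) (d x y : R) : R :=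
  d ^- 3 * g ((x - y) / d).

Lemma rescaled_ge0 g d x y : kernel_profile g -> 0 < d ->
  0 <= rescaled g d x y.
Proof.
move=> [g0 _ _ _] d0; apply: mulr_ge0; last exact: g0.
by rewrite invr_ge0 exprn_ge0// ltW.
Qed.

Lemma rescaled_sym g d x y : kernel_profile g ->
  rescaled g d x y = rescaled g d y x.
Proof.
by move=> [_ ge _ _]; rewrite /rescaled -(opprB y x) mulNr ge.
Qed.

Lemma rescaled_support g d x y : kernel_profile g -> 0 < d ->
  d < `|x - y| -> rescaled g d x y = 0.
Proof.
move=> [_ _ _ gs] d0 dxy; rewrite /rescaled gs ?mulr0//.
by rewrite normrM normfV (gtr0_norm d0) ltr_pdivlMr// mul1r.
Qed.

(* sup over x in A of the integral of the rescaled kernel on B_d(x) `&` A *)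
Definition kernel_mass_sup (A : set R) (g : R -> R) (d : R) : \bar R :=
  ereal_sup [set \int[mu]_(y in ball x d `&` A) (rescaled g d x y)%:E
            | x in A]%E.

(* The constant K hidden in the symbol "lesssim" may depend on a, b, alpha, but
   not on the horizons d1 and d2. *)
Definition kernel_mass_bound (g1 g2 : R -> R) (a b alpha : R) : Prop :=
  exists K : R, forall d1 d2 : R,
    let G := Config a b alpha d1 d2 in
    admissible G ->
    (kernel_mass_sup (Omega1 G `|` I1 G) g1 d1 <= (K * d1 ^- 2)%:E)%E /\
    (kernel_mass_sup (Omega2 G `|` I2 G) g2 d2 <= (K * d2 ^- 2)%:E)%E.

End kernels.

Section spaces.
Context {R : realType}.
Local Notation mu := (@lebesgue_measure R).
Implicit Types (G : config R) (v : R -> R).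

(* L2 functions are handled through representatives v : R -> R; values outside
   Omega1 G `|` Omega2 G and the I_i^D play no role. *)
Definition V0 G : set (R -> R) :=
  [set v | [/\ v \_ (Omega1 G `|` Omega2 G) \in Lfun mu 2%:E,
               forall x, I1D G x -> v x = 0 &
               forall x, I2D G x -> v x = 0]].

Definition L2norm (A : set R) v : \bar R := 'N[mu]_2%:E[EFin \o v \_ A]%E.

(* Both v_1 and v_2 are restrictions of v to subsets of R, hence a single v *)
Definition energy (A B : set R) (k : R -> R -> R) v : \bar R :=
  (\int[mu]_(x in A) \int[mu]_(y in B) ((v x - v y) ^+ 2 * k x y)%:E)%E.

Definition sqnorm1 (g1 : R -> R) G v : \bar R :=
  let A := Omega1 G `|` I1D G in
  ((2^-1)%:E * energy A A (rescaled g1 (cd1 G)) v)%E.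

Definition sqnorm2 (g2 : R -> R) G v : \bar R :=
  let A := Omega2 G `|` I2D G in
  ((2^-1)%:E * energy A A (rescaled g2 (cd2 G)) v)%E.

Definition sqnormGamma (g1 g2 : R -> R) G v : \bar R :=
  ((2^-1)%:E * (energy (I2J G) (I1J G) (rescaled g1 (cd1 G)) v
              + energy (I1J G) (I2J G) (rescaled g2 (cd2 G)) v)
   + energy (I2J G) (Omega2J G) (rescaled g2 (cd2 G)) v)%E.

Definition delta_norm (g1 g2 : R -> R) G v : \bar R :=
  ((sqnorm1 g1 G v + sqnorm2 g2 G v + sqnormGamma g1 g2 G v) `^ 2^-1)%E.

End spaces.

(* Main.v *)
Require Import Defs.
From HB Require Import structures.
From mathcomp Require Import all_boot all_order all_algebra.
From mathcomp Require Import all_classical all_reals all_analysis.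
From mathcomp Require Import measurable_realfun.
From mathcomp Require Import ring lra.

Import Order.TTheory GRing.Theory Num.Theory.
Import numFieldNormedType.Exports.

Local Open Scope classical_set_scope.
Local Open Scope ring_scope.

(* Lower bound. If w vanishes on (-oo, c], a point of (c, e) is carried there by
   at most L/h + 1 steps of length h, so telescoping gives
     h^2 * int_(c,e) w^2 <= 4 L^2 * int_(c,e) (w(x) - w(x - h))^2 dx
   for 0 < h <= L and e - c <= L. Taking h = d s, multiplying by g(s) / d^2 and
   integrating over s in (0, 1) turns the left-hand side into sigma * int w^2,
   and the substitution y = x - d s turns the right-hand side into the part
   y < x of the energy for the rescaled kernel. This applies to Omega1 from the
   left and, after reflection, to Omega2 from the right; the coupling term on
   Gamma is only needed to be nonnegative.
   Upper bound. (w(x) - w(y))^2 <= 2 w(x)^2 + 2 w(y)^2, and the rescaled kernel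
   has total mass d^-2 * int g, which is finite. *)

(** * Affine changes of variable and Tonelli's theorem on measurable sets *)

Section integration.
Set Implicit Arguments.
Unset Strict Implicit.
Context {R : realType}.
Local Notation mu := (@lebesgue_measure R).

Lemma measurable_affine (c t : R) :
  measurable_fun [set: R] (fun x : R => c * x + t).
Proof. by apply: measurable_funD => //; exact: measurable_funM. Qed.

Lemma affine_preimage_pos (c t x y : R) : 0 < c ->
  (fun z => c * z + t) @^-1` `]x, y] = `](x - t) / c, (y - t) / c]%classic.
Proof.
move=> c0; apply/seteqP; split => z /=; rewrite !in_itv/=;
by rewrite ltr_pdivrMr// ler_pdivlMr// ltrBlDr lerBrDr (mulrC z).
Qed.

Lemma affine_preimage_neg (c t x y : R) : c < 0 ->
  (fun z => c * z + t) @^-1` `]x, y] = `[(y - t) / c, (x - t) / c[%classic.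
Proof.
move=> c0; apply/seteqP; split => z /=; rewrite !in_itv/= andbC;
by rewrite ler_ndivrMr// ltr_ndivlMr// ltrBlDr lerBrDr (mulrC z).
Qed.

(** By uniqueness of Lebesgue measure it suffices to compare both sides on intervals []x, y]]. For
    [c < 0] the preimage is half-open on the other side, which does not change its length. *)
Lemma lebesgue_measure_affine (c t : R) (A : set R) : c != 0 ->
  measurable A ->
  mu A = (`|c|%:E * mu ((fun x => c * x + t)%R @^-1` A))%E.
Proof.
move=> c0 mA.
pose phi : measurableTypeR R -> measurableTypeR R := fun x => c * x + t.
have mphi : measurable_fun setT phi by exact: measurable_affine.
pose nu := mscale (NngNum (normr_ge0 c)) (pushforward mu phi).
rewrite (@lebesgue_measure_unique _ (nu mphi))// => _ [[x y] _ <-] /=.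
rewrite /nu /mscale /pushforward /phi/=.
move: c0; rewrite neq_lt => /orP[c0|c0].
- transitivity (`|c|%:E * mu (`[(y - t) / c, (x - t) / c[%classic)%R)%E; last first.
    by congr (_ * mu _)%E; exact/esym/affine_preimage_neg.
  rewrite !lebesgue_measure_itv/= !lte_fin.
  rewrite ltr_ndivlMr// divfK ?lt_eqF// ltrD2r.
  case: ifPn => _; last by rewrite mule0.
  by rewrite -!EFinD -EFinM ltr0_norm//; congr EFin; field; rewrite lt_eqF.
- transitivity (`|c|%:E * mu (`](x - t) / c, (y - t) / c]%classic)%R)%E; last first.
    by congr (_ * mu _)%E; exact/esym/affine_preimage_pos.
  rewrite !lebesgue_measure_itv/= !lte_fin.
  rewrite ltr_pdivrMr// divfK ?gt_eqF// ltrD2r.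
  case: ifPn => _; last by rewrite mule0.
  by rewrite -!EFinD -EFinM gtr0_norm//; congr EFin; field; rewrite gt_eqF.
Qed.

Local Open Scope ereal_scope.

(** Lebesgue measure is [|c|] times its image under the affine map, so this is integration against
    an image measure. Either sign of [c] is allowed, which covers translations, reflections and
    [s = (x - y) / d]. *)
Lemma ge0_integral_affine (c t : R) (A : set R) (f : R -> \bar R) :
  c != 0%R -> measurable A -> measurable_fun A f ->
  (forall x, A x -> 0 <= f x) ->
  \int[mu]_(x in A) f x =
  `|c|%:E * \int[mu]_(x in (fun x => c * x + t)%R @^-1` A) f (c * x + t)%R.
Proof.
move=> c0 mA mf f0.
pose phi : measurableTypeR R -> measurableTypeR R := fun x => (c * x + t)%R.
have mphi : measurable_fun setT phi by exact: measurable_affine.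
pose nu := mscale (NngNum (normr_ge0 c)) (pushforward mu phi).
rewrite (@eq_measure_integral _ _ _ _ (nu mphi)); last first.
  by move=> B mB _; exact: lebesgue_measure_affine.
rewrite ge0_integral_mscale//; congr (_ * _).
by rewrite ge0_integral_pushforward// => x; rewrite inE; exact: f0.
Qed.

Lemma ge0_integral_setTE (A : set R) (f : R -> \bar R) :
  (forall x, ~ A x -> f x = 0) -> \int[mu]_x f x = \int[mu]_(x in A) f x.
Proof.
move=> f0; rewrite [RHS]integral_mkcond; apply: eq_integral => x _.
by rewrite patchE; case: ifPn => // /negP; rewrite inE => /f0.
Qed.

(** Extension by zero off [A * B] turns iterated integrals over sets into integrals over the whole
    line, where the Fubini-Tonelli theorem applies. *)
Lemma tonelli_patch (A B : set R) (F : R * R -> \bar R) (x : R) :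
  \int[mu]_y (F \_ (A `*` B)) (x, y) =
  ((fun x => \int[mu]_(y in B) F (x, y)) \_ A) x.
Proof.
rewrite patchE; case: ifPn => [|/negP]; rewrite inE => Ax.
  rewrite [RHS]integral_mkcond; apply: eq_integral => y _; rewrite !patchE.
  by congr (if _ then _ else _); apply/idP/idP; rewrite !inE//= => -[].
apply: integral0_eq => y _; rewrite patchE ifF//.
by apply/negP; rewrite inE/= => -[].
Qed.

Lemma measurable_section_integral (A B : set R) (F : R * R -> \bar R) :
  measurable A -> measurable B -> measurable_fun setT F ->
  (forall z, 0 <= F z) ->
  measurable_fun A (fun x => \int[mu]_(y in B) F (x, y)).
Proof.
move=> mA mB mF F0; apply/(measurable_restrictT _ _) => //.
rewrite (_ : _ \_ A = fun x => \int[mu]_y (F \_ (A `*` B)) (x, y)); last first.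
  by apply/funext => x; rewrite tonelli_patch.
apply: (@measurable_fun_fubini_tonelli_F _ _ _ _ _ mu (F \_ (A `*` B))).
- apply: (measurable_restrictT F (measurableX mA mB)).1.
  exact: measurable_funTS.
- by move=> z; exact: erestrict_ge0.
Qed.

Lemma tonelli_set (A B : set R) (F : R * R -> \bar R) :
  measurable A -> measurable B -> measurable_fun setT F ->
  (forall z, 0 <= F z) ->
  \int[mu]_(x in A) \int[mu]_(y in B) F (x, y) =
  \int[mu]_(y in B) \int[mu]_(x in A) F (x, y).
Proof.
move=> mA mB mF F0.
rewrite integral_mkcond [RHS]integral_mkcond.
transitivity (\int[mu]_x \int[mu]_y (F \_ (A `*` B)) (x, y)).
  by apply: eq_integral => x _; rewrite tonelli_patch.
rewrite (@fubini_tonelli _ _ _ _ _ mu mu (F \_ (A `*` B))); last 2 first.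
- apply: (measurable_restrictT F (measurableX mA mB)).1.
  exact: measurable_funTS.
- by move=> z; exact: erestrict_ge0.
apply: eq_integral => y _.
(* Integration in the first variable is the same patching identity for [F] with its arguments
   swapped. *)
have := tonelli_patch B A (F \o (fun z => (z.2, z.1))) y; rewrite /= => <-.
apply: eq_integral => x _; rewrite !patchE/=.
by congr (if _ then _ else _); apply/idP/idP; rewrite !inE/= => -[].
Qed.

End integration.

(** * A Poincaré inequality for differences with a fixed step *)

Section poincare.
Set Implicit Arguments.
Unset Strict Implicit.
Context {R : realType}.
Local Notation mu := (@lebesgue_measure R).
Local Open Scope ereal_scope.
Implicit Types (w g : R -> R) (A B : set R).

Lemma measurable_shift w (h : R) : measurable_fun setT w ->
  measurable_fun setT (fun x : R => w (x - h)%R).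
Proof.
by move=> mw; apply: measurableT_comp => //; exact: measurable_funB.
Qed.

Lemma measurable_sqr_diff w (h : R) A : measurable_fun setT w ->
  measurable_fun A (fun x : R => ((w x - w (x - h)) ^+ 2)%:E).
Proof.
move=> mw; apply: measurable_funTS; apply/measurable_EFinP.
by apply: measurable_funX; apply: measurable_funB => //; exact: measurable_shift.
Qed.

Lemma measurable_sqr w A : measurable_fun setT w ->
  measurable_fun A (fun x : R => (w x ^+ 2)%:E).
Proof.
by move=> mw; apply: measurable_funTS; apply/measurable_EFinP; exact: measurable_funX.
Qed.

(* With these weights, [C(n+2) = n.+2 + n.+2 / n.+1 * C(n+1)] is solved by
   [C(n) = n ^ 2] in the induction of [shift_iteration]. *)
Lemma sqr_young (n : nat) (p q : R) :
  ((p + q) ^+ 2 <= n.+2%:R * p ^+ 2 + n.+2%:R / n.+1%:R * q ^+ 2)%R.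
Proof.
rewrite -subr_ge0.
have n0 : (0 < n.+1%:R :> R)%R by [].
have -> : (n.+2%:R * p ^+ 2 + n.+2%:R / n.+1%:R * q ^+ 2 - (p + q) ^+ 2 =
  (n.+1%:R * p - q) ^+ 2 / n.+1%:R :> R)%R.
  by rewrite -[n.+2%:R]natr1; field; rewrite gt_eqF.
by rewrite divr_ge0// ?sqr_ge0// ltW.
Qed.

(** Induction on the number of steps, splitting [w x] into [w x - w (x - h)] and [w (x - h)].
    Half-lines are used because the shift sends []-oo, t[] to the smaller half-line []-oo, t - h[],
    to which the induction hypothesis applies. *)
Lemma shift_iteration w (c h t : R) (n : nat) : measurable_fun setT w ->
  (0 < h)%R -> (forall x, (x <= c)%R -> w x = 0%R) ->
  (t <= c + n.+1%:R * h)%R ->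
  \int[mu]_(x in `]-oo, t[) (w x ^+ 2)%:E <=
  (n.+1%:R ^+ 2)%:E *
    \int[mu]_(x in `]-oo, t[) ((w x - w (x - h)) ^+ 2)%:E.
Proof.
move=> mw h0 wc.
have mt u : measurable (`]-oo, u[%classic : set R) by [].
elim: n t => [|n IH] t tn.
  (* With a single step, [x < t <= c + h] gives [w (x - h) = 0], so both integrands coincide. *)
  rewrite expr1n mul1e le_eqVlt; apply/orP; left; apply/eqP.
  apply: eq_integral => x; rewrite inE/= in_itv/= => xt.
  by rewrite (wc (x - h)%R) ?subr0//; lra.
set E := \int[mu]_(x in _) ((w x - _) ^+ 2)%:E.
have IHt : \int[mu]_(x in `]-oo, t[) (w (x - h)%R ^+ 2)%:E <=
    (n.+1%:R ^+ 2)%:E * E.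
  have -> : \int[mu]_(x in `]-oo, t[) (w (x - h)%R ^+ 2)%:E =
      \int[mu]_(x in `]-oo, (t - h)%R[) (w x ^+ 2)%:E.
    rewrite [RHS](@ge0_integral_affine _ 1 (- h)%R)//; last 2 first.
    - exact: measurable_sqr.
    - by move=> x _; rewrite lee_fin sqr_ge0.
    rewrite normr1 mul1e; under [RHS]eq_integral do rewrite mul1r.
    congr integral; apply/seteqP; split => x /=; rewrite !in_itv/= mul1r; lra.
  (* The hypothesis at [t - h] yields differences on the shorter half-line; by nonnegativity the
     domain is enlarged back to []-oo, t[]. *)
  apply: (le_trans (IH (t - h)%R _)).
    by move: tn; rewrite -[n.+2%:R]natr1; lra.
  apply: lee_wpmul2l; first by rewrite lee_fin sqr_ge0.
  apply: ge0_subset_integral => //.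
  - exact: measurable_sqr_diff.
  - by move=> x _; rewrite lee_fin sqr_ge0.
  - by move=> x /=; rewrite !in_itv/=; lra.
have E0 : 0 <= E by apply: integral_ge0 => x _; rewrite lee_fin sqr_ge0.
pose k : R := (n.+2%:R / n.+1%:R)%R.
have k0 : (0 <= k)%R by rewrite divr_ge0.
have mD := measurable_sqr_diff h (A := `]-oo, t[%classic) mw.
have mS : measurable_fun (`]-oo, t[%classic : set R)
    (fun x : R => (w (x - h)%R ^+ 2)%:E).
  by apply: measurable_sqr; exact: measurable_shift.
apply: (@le_trans _ _ (\int[mu]_(x in `]-oo, t[)
    (n.+2%:R%:E * ((w x - w (x - h)) ^+ 2)%:E + k%:E * (w (x - h)%R ^+ 2)%:E))).
  apply: ge0_le_integral => //.
  - by move=> x _; rewrite lee_fin sqr_ge0.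
  - exact: measurable_sqr.
  - by apply: emeasurable_funD; apply: emeasurable_funM.
  - move=> x _; rewrite -!EFinM -EFinD lee_fin.
    by have := sqr_young n (w x - w (x - h)%R) (w (x - h)%R); rewrite subrK.
rewrite ge0_integralD//; last 4 first.
- by move=> x _; rewrite -EFinM lee_fin mulr_ge0// sqr_ge0.
- exact: emeasurable_funM.
- by move=> x _; rewrite -EFinM lee_fin mulr_ge0// sqr_ge0.
- exact: emeasurable_funM.
rewrite !ge0_integralZl_EFin//; last 2 first.
- by move=> x _; rewrite lee_fin sqr_ge0.
- by move=> x _; rewrite lee_fin sqr_ge0.
apply: (@le_trans _ _ (n.+2%:R%:E * E + k%:E * ((n.+1%:R ^+ 2)%:E * E))).
  by apply: leeD => //; apply: lee_wpmul2l.
rewrite muleA -EFinM -ge0_muleDl ?lee_fin//; last first.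
  by rewrite mulr_ge0// sqr_ge0.
rewrite -EFinD; apply: lee_wpmul2r => //; rewrite lee_fin le_eqVlt.
apply/orP; left; apply/eqP; rewrite /k -[n.+2%:R]natr1.
by field; rewrite gt_eqF.
Qed.

Lemma shift_poincare w (c e h L : R) : measurable_fun setT w ->
  (0 < h <= L)%R -> (e - c <= L)%R -> (forall x, (x <= c)%R -> w x = 0%R) ->
  (h ^+ 2)%:E * \int[mu]_(x in `]c, e[) (w x ^+ 2)%:E <=
  (4 * L ^+ 2)%:E *
    \int[mu]_(x in `]c, e[) ((w x - w (x - h)) ^+ 2)%:E.
Proof.
move=> mw /andP[h0 hL] ecL wc.
(* Both integrands vanish left of [c], the second one because [x - h <= c] as well, so the interval
   can be replaced by a half-line. *)
have crop (f : R -> R) : (forall x, (x <= c)%R -> f x = 0%R) ->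
    \int[mu]_(x in `]c, e[) (f x)%:E = \int[mu]_(x in `]-oo, e[) (f x)%:E.
  move=> f0; rewrite integral_mkcond [RHS]integral_mkcond.
  apply: eq_integral => x _; rewrite !patchE; case: (leP x c) => xc.
    by rewrite f0//; do 2 case: ifP.
  by congr (if _ then _ else _); apply/idP/idP;
    rewrite !inE/= !in_itv/= xc.
rewrite crop; last by move=> x /wc ->; rewrite expr0n.
rewrite crop; last first.
  by move=> x xc; rewrite !wc ?subr0 ?expr0n//; lra.
have Lh0 : (0 <= L / h)%R by rewrite divr_ge0//; lra.
(* From [n * h <= L < n.+1 * h], the [n.+1] steps cover the length [e - c <= L]; since [h <= L],
   also [n.+1 * h <= 2 * L], whose square is the constant [4 * L ^+ 2]. *)
pose n := Num.truncn (L / h)%R.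
have /andP[nL Ln] := truncn_itv Lh0.
have nL1 : (n%:R * h <= L)%R by rewrite -ler_pdivlMr.
have Ln1 : (L < n.+1%:R * h)%R by rewrite -ltr_pdivrMr.
have en : (e <= c + n.+1%:R * h)%R by lra.
have I0 : 0 <= \int[mu]_(x in `]-oo, e[) ((w x - w (x - h)) ^+ 2)%:E.
  by apply: integral_ge0 => x _; rewrite lee_fin sqr_ge0.
apply: le_trans (lee_wpmul2l _ (shift_iteration mw h0 wc en)) _.
  by rewrite lee_fin sqr_ge0.
rewrite muleA -EFinM; apply: lee_wpmul2r => //; rewrite lee_fin.
rewrite -exprMn [leRHS](_ : _ = (2 * L) ^+ 2)%R; last by ring.
rewrite ler_pXn2r ?nnegrE//.
- by move: nL1; rewrite -natr1; lra.
- by rewrite mulr_ge0// ltW.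
- lra.
Qed.

End poincare.

(** * Nonlocal Poincaré inequalities for rescaled kernels *)

Section kernel.
Set Implicit Arguments.
Unset Strict Implicit.
Context {R : realType}.
Local Notation mu := (@lebesgue_measure R).
Local Open Scope ereal_scope.
Implicit Types (w g : R -> R) (A B : set R).

Lemma measurable_profile g : kernel_profile g -> measurable_fun setT g.
Proof. by case=> _ _ []. Qed.

Lemma measurable_rescaled g (d : R) : kernel_profile g ->
  measurable_fun setT (fun z : R * R => rescaled g d z.1 z.2).
Proof.
move=> /measurable_profile mg; apply: measurable_funM => //.
apply: measurableT_comp mg _; apply: measurable_funM => //.
exact: measurable_funB.
Qed.

Lemma measurable_weighted_rescaled g (d : R) (f : R * R -> R) :
  kernel_profile g -> measurable_fun setT f ->
  measurable_fun setT (fun z : R * R => (f z * rescaled g d z.1 z.2)%:E).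
Proof.
move=> hg mf; apply/measurable_EFinP; apply: measurable_funM => //.
exact: measurable_rescaled.
Qed.

Lemma measurable_energy_density g (d : R) w : kernel_profile g ->
  measurable_fun setT w ->
  measurable_fun setT
    (fun z : R * R => ((w z.1 - w z.2) ^+ 2 * rescaled g d z.1 z.2)%:E).
Proof.
move=> hg mw.
apply: (measurable_weighted_rescaled d hg (f := fun z => (w z.1 - w z.2) ^+ 2)%R).
by apply: measurable_funX; apply: measurable_funB; exact: measurableT_comp.
Qed.

Lemma energy_density_ge0 g (d x y : R) w : kernel_profile g -> (0 < d)%R ->
  0 <= ((w x - w y) ^+ 2 * rescaled g d x y)%:E.
Proof.
by move=> hg d0; rewrite lee_fin mulr_ge0 ?sqr_ge0//; exact: rescaled_ge0.
Qed.

Lemma ge0_integral_opp A (f : R -> \bar R) : measurable A ->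
  measurable_fun A f -> (forall x, A x -> 0 <= f x) ->
  \int[mu]_(x in A) f x = \int[mu]_(x in -%R @^-1` A) f (- x)%R.
Proof.
move=> mA mf f0; rewrite (@ge0_integral_affine _ (-1) 0)//.
rewrite normrN1 mul1e (_ : (fun x : R => -1 * x + 0)%R = -%R).
  by under eq_integral do rewrite mulN1r addr0.
by apply/funext => x; rewrite mulN1r addr0.
Qed.

(** Evenness makes the two halves of the moment equal, which cancels the factor 1/2; endpoints are
    null sets. *)
Lemma half_second_momentE g : kernel_profile g ->
  half_second_moment g = \int[mu]_(s in `]0%R, 1%R[) (s ^+ 2 * g s)%:E.
Proof.
move=> hg; have mg := measurable_profile hg; have [g0 ge _ _] := hg.
pose f : R -> R := (fun s => s ^+ 2 * g s)%R.
have mf A : measurable_fun A (EFin \o f).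
  by apply: measurable_funTS; apply/measurable_EFinP; exact: measurable_funM.
have f0 x : 0 <= (f x)%:E by rewrite lee_fin mulr_ge0 ?sqr_ge0.
rewrite /half_second_moment -/f.
rewrite (@integral_itv_bndoo _ (-1) 1 (EFin \o f))//.
rewrite (@itv_bndbnd_setU _ _ _ (BRight 0%R)) ?bnd_simp//.
rewrite ge0_integral_setU//; last 3 first.
- exact: mf.
- by move=> x _; exact: f0.
- apply/disj_setPLR => x /=; rewrite !in_itv/= => /andP[_ x0].
  by apply/negP; rewrite negb_and -leNgt x0.
rewrite -integral_itv_bndo_bndc; last exact: mf.
rewrite [X in X + _]ge0_integral_opp//; last by move=> x _; exact: f0.
rewrite opp_preimage_itvbndbnd/= oppr0 opprK.
under [X in X + _]eq_integral do rewrite /f ge sqrrN.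
rewrite -/f -mule2n -[X in _ * X]mule_natl muleA -EFinM mulVf ?mul1e//.
Qed.

(** An even profile is unchanged when both variables are reflected. This transfers the estimate at a
    left end to a right end. *)
Lemma energy_opp g (d : R) w A : kernel_profile g -> (0 < d)%R ->
  measurable_fun setT w -> measurable A ->
  energy A A (rescaled g d) w =
  energy (-%R @^-1` A) (-%R @^-1` A) (rescaled g d) (w \o -%R).
Proof.
move=> hg d0 mw mA; have mF := measurable_energy_density d hg mw.
rewrite /energy ge0_integral_opp; first last.
- by move=> x _; apply: integral_ge0 => y _; exact: energy_density_ge0.
- apply: (measurable_section_integral mA mA mF) => z.
  exact: energy_density_ge0.
- exact: mA.
apply: eq_integral => x _; rewrite ge0_integral_opp //; last 2 first.
- apply: measurable_funTS; exact: (measurable_fun_pair2 _ mF).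
- by move=> y _; exact: energy_density_ge0.
apply: eq_integral => y _ /=; congr (_ * _)%:E; rewrite /rescaled.
by have [_ ge _ _] := hg; rewrite -opprD mulNr ge.
Qed.

(** [shift_poincare] with step [d * s] is averaged over [s] in (0, 1); after exchanging the
    integrals, the variable [s] is traded for [y = x - d * s]. *)
Lemma poincare_left g (sigma c e d L : R) w :
  kernel_profile g -> half_second_moment g = sigma%:E ->
  (0 < d <= L)%R -> (e - c <= L)%R -> measurable_fun setT w ->
  (forall x, (x <= c)%R -> w x = 0%R) ->
  sigma%:E * \int[mu]_(x in `]c, e[) (w x ^+ 2)%:E <=
  (4 * L ^+ 2)%:E * energy (`]c, e[ `|` `](c - d)%R, c[)%classic
    (`]c, e[ `|` `](c - d)%R, c[)%classic (rescaled g d) w.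
Proof.
move=> hg hsigma /andP[d0 dL] ecL mw wc.
set A := (_ `|` _)%classic.
have mg := measurable_profile hg; have [g0 _ _ _] := hg.
pose W := \int[mu]_(x in `]c, e[) (w x ^+ 2)%:E.
have W0 : 0 <= W by apply: integral_ge0 => x _; rewrite lee_fin sqr_ge0.
pose D z := ((w z.1 - w z.2) ^+ 2 * rescaled g d z.1 z.2)%:E.
have mD : measurable_fun setT D by exact: measurable_energy_density.
have D0 z : 0 <= D z by exact: energy_density_ge0.
have mDx x B : measurable_fun B (fun y => D (x, y)).
  by apply: measurable_funTS; exact: (measurable_fun_pair2 _ mD).
have mA : measurable A by exact: measurableU.
have L0 : (0 <= 4 * L ^+ 2)%R by rewrite mulr_ge0// sqr_ge0.
(* The factor [d ^- 2] cancels the square of the step [d * s], leaving the density [s ^+ 2 * g s] of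
   the second moment. *)
pose q s := (d ^- 2 * g s)%R.
have q0 s : (0 <= q s)%R by rewrite mulr_ge0// invr_ge0 sqr_ge0.
have mq : measurable_fun setT q by exact: measurable_funM.
pose F z := (4 * L ^+ 2 * q z.2 * (w z.1 - w (z.1 - d * z.2)) ^+ 2)%:E.
have mF : measurable_fun setT F.
  apply/measurable_EFinP; apply: measurable_funM.
    by apply: measurable_funM => //; exact: (measurableT_comp mq).
  apply: measurable_funX; apply: measurable_funB.
    exact: (measurableT_comp mw).
  apply: (measurableT_comp mw); apply: measurable_funB => //.
  exact: measurable_funM.
have F0 z : 0 <= F z by rewrite lee_fin mulr_ge0 ?sqr_ge0// mulr_ge0.
rewrite -hsigma half_second_momentE//.
rewrite -(@ge0_integralZr _ _ _ mu)//; last 2 first.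
- apply: measurable_funTS; apply/measurable_EFinP; exact: measurable_funM.
- by move=> s _; rewrite lee_fin mulr_ge0 ?sqr_ge0.
apply: (@le_trans _ _ (\int[mu]_(s in `]0%R, 1%R[) \int[mu]_(x in `]c, e[)
    F (x, s))).
  apply: ge0_le_integral => //.
  - by move=> s _; rewrite mule_ge0// lee_fin mulr_ge0 ?sqr_ge0.
  - apply: emeasurable_funM => //.
    by apply: measurable_funTS; apply/measurable_EFinP; exact: measurable_funM.
  - apply: (@measurable_section_integral _ _ _ (fun z => F (z.2, z.1))) => //.
    exact: (measurableT_comp mF (@measurable_swap _ _ _ _)).
  - move=> s /=; rewrite in_itv/= => /andP[s0 s1].
    have h0L : (0 < d * s <= L)%R.
      by rewrite mulr_gt0//= (le_trans _ dL)// ler_piMr// ltW.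
    rewrite (_ : (s ^+ 2 * g s = q s * (d * s) ^+ 2)%R); last first.
      by rewrite /q; field; rewrite gt_eqF.
    rewrite EFinM -muleA.
    apply: le_trans (lee_wpmul2l _ (shift_poincare mw h0L ecL wc)) _.
      by rewrite lee_fin.
    rewrite muleA -EFinM -ge0_integralZl_EFin//.
    + rewrite le_eqVlt; apply/orP; left; apply/eqP.
      by apply: eq_integral => x _; rewrite -EFinM /F/= (mulrC (q s)).
    + by move=> x _; rewrite lee_fin sqr_ge0.
    + exact: measurable_sqr_diff.
    + by rewrite mulr_ge0.
rewrite -(@tonelli_set _ _ _ F)//.
(* Under [s = (x - y) / d], the Jacobian [d^-1] and the factor [d ^- 2] of [q] combine into the
   [d ^- 3] of the rescaled kernel, and (0, 1) becomes [](x - d), x[]. *)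
have FD x : \int[mu]_(s in `]0%R, 1%R[) F (x, s) =
    (4 * L ^+ 2)%:E * \int[mu]_(y in `](x - d)%R, x[) D (x, y).
  have dV0 : (0 < d^-1)%R by rewrite invr_gt0.
  have affE y : (- d^-1 * y + x / d = (x - y) / d)%R.
    by field; rewrite gt_eqF.
  rewrite (@ge0_integral_affine _ (- d^-1) (x / d))//; last 2 first.
  - by rewrite oppr_eq0 invr_eq0 gt_eqF.
  - by apply: measurable_funTS; exact: (measurable_fun_pair2 _ mF).
  rewrite normrN gtr0_norm// (_ : _ @^-1` _ = `](x - d)%R, x[%classic); last first.
    apply/seteqP; split => y /=; rewrite !in_itv/= affE;
    by rewrite ltr_pdivlMr// ltr_pdivrMr// mul0r mul1r; lra.
  rewrite -!ge0_integralZl_EFin// ?ltW//; last 2 first.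
  - exact: mDx.
  - apply: measurable_funTS.
    exact: (measurableT_comp (measurable_fun_pair2 x mF)
      (measurable_affine _ _)).
  apply: eq_integral => y _; rewrite /F /D /q /rescaled -!EFinM /=.
  rewrite (_ : (x - d * (- d^-1 * y + x / d) = y)%R); last first.
    by field; rewrite gt_eqF.
  rewrite affE.
  by congr EFin; field; rewrite gt_eqF.
have mI B : measurable_fun B (fun x => \int[mu]_(y in A) D (x, y)).
  apply: measurable_funTS; exact: measurable_section_integral.
have I0 B x : 0 <= \int[mu]_(y in B) D (x, y) by apply: integral_ge0.
apply: (@le_trans _ _ (\int[mu]_(x in `]c, e[)
    ((4 * L ^+ 2)%:E * \int[mu]_(y in A) D (x, y)))).
  apply: ge0_le_integral => //.
  - by move=> x _; exact: integral_ge0.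
  - exact: measurable_section_integral.
  - exact: (emeasurable_funM (measurable_cst _) (mI _)).
  - move=> x /=; rewrite in_itv/= FD => /andP[cx xe].
    apply: lee_wpmul2l; rewrite ?lee_fin//.
    (* For [c < x < e], the interval [](x - d), x[] lies in [](c - d), e[], and [A] misses only the
       null point [c] of the latter. *)
    rewrite (_ : A = `](c - d)%R, e[%classic `\ c); last first.
      apply/seteqP; split => y; rewrite /A/= !in_itv/=.
        by move=> [] /andP[? ?]; split; try (apply/eqP; rewrite neq_lt); lra.
      move=> [/andP[y1 y2] /eqP]; rewrite neq_lt => /orP[yc|yc]; [right|left];
        lra.
    rewrite integral_setD1//; last exact: measurableD.
    apply: ge0_subset_integral => //; first exact: mDx.
    by move=> y /=; rewrite !in_itv/=; lra.
rewrite ge0_integralZl_EFin//; last exact: mI.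
apply: lee_wpmul2l; rewrite ?lee_fin//.
apply: ge0_subset_integral => //; [exact: mI|exact: subsetUl].
Qed.

Lemma poincare_right g (sigma c e d L : R) w :
  kernel_profile g -> half_second_moment g = sigma%:E ->
  (0 < d <= L)%R -> (e - c <= L)%R -> measurable_fun setT w ->
  (forall x, (e <= x)%R -> w x = 0%R) ->
  sigma%:E * \int[mu]_(x in `]c, e[) (w x ^+ 2)%:E <=
  (4 * L ^+ 2)%:E * energy (`]c, e[ `|` `]e, (e + d)%R[)%classic
    (`]c, e[ `|` `]e, (e + d)%R[)%classic (rescaled g d) w.
Proof.
move=> hg hsigma dL ecL mw we; have /andP[d0 _] := dL.
rewrite energy_opp//; last exact: measurableU.
rewrite preimage_setU !opp_preimage_itvbndbnd/= opprD.
rewrite ge0_integral_opp//; last 2 first.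
- exact: measurable_sqr.
- by move=> x _; rewrite lee_fin sqr_ge0.
rewrite opp_preimage_itvbndbnd/=.
apply: poincare_left => //.
- by rewrite opprK addrC.
- exact: measurableT_comp.
- by move=> x xe /=; rewrite we//; lra.
Qed.

End kernel.

(** * Upper bound for the energy, square roots, and insensitivity to one point *)

Section upper_bound.
Set Implicit Arguments.
Unset Strict Implicit.
Context {R : realType}.
Local Notation mu := (@lebesgue_measure R).
Local Open Scope ereal_scope.
Implicit Types (v w g : R -> R) (A B : set R).

(** The profile vanishes outside the compact interval [[-1, 1]], on which local integrability gives
    a finite integral. *)
Lemma profile_integral_fin_num g : kernel_profile g ->
  \int[mu]_s (g s)%:E \is a fin_num.
Proof.
case=> g0 _ [mg _ gint] gs.
rewrite ge0_fin_numE; last by apply: integral_ge0 => s _; rewrite lee_fin.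
rewrite (@ge0_integral_setTE _ `[(-1)%R, 1%R]); last first.
  move=> s; rewrite /= in_itv/= -ler_norml => /negP; rewrite -ltNge => /gs ->.
  by [].
have := gint `[(-1)%R, 1%R]%classic (@subsetT _ _) (@segment_compact _ _ _).
by under eq_integral do rewrite ger0_norm//.
Qed.

Lemma integral_rescaled g (d x : R) : kernel_profile g -> (0 < d)%R ->
  \int[mu]_y (rescaled g d x y)%:E = (d ^- 2)%:E * \int[mu]_s (g s)%:E.
Proof.
move=> hg d0; have mg := measurable_profile hg; have [g0 _ _ _] := hg.
have d20 : (0 <= d ^- 2)%R by rewrite invr_ge0 sqr_ge0.
rewrite -ge0_integralZl_EFin//; last 2 first.
- by move=> s _; rewrite lee_fin.
- exact/measurable_EFinP.
rewrite [RHS](@ge0_integral_affine _ (- d^-1) (x / d))//; last 3 first.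
- by rewrite oppr_eq0 invr_eq0 gt_eqF.
- by apply: emeasurable_funM => //; exact/measurable_EFinP.
- by move=> s _; rewrite -EFinM lee_fin mulr_ge0.
have dV0 : (0 < d^-1)%R by rewrite invr_gt0.
rewrite normrN gtr0_norm// preimage_setT -ge0_integralZl_EFin//; last 3 first.
- by move=> s _; rewrite -EFinM lee_fin mulr_ge0.
- apply: emeasurable_funM => //; apply/measurable_EFinP.
  exact: (measurableT_comp mg (measurable_affine _ _)).
- exact: ltW.
apply: eq_integral => y _; rewrite -!EFinM /rescaled; congr EFin.
rewrite (_ : (- d^-1 * y + x / d = (x - y) / d)%R); last first.
  by field; rewrite gt_eqF.
by field; rewrite gt_eqF.
Qed.

Lemma energy_leT g (d : R) w A B : kernel_profile g -> (0 < d)%R ->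
  measurable_fun setT w -> measurable A -> measurable B ->
  energy A B (rescaled g d) w <= energy setT setT (rescaled g d) w.
Proof.
move=> hg d0 mw mA mB; have mD := measurable_energy_density d hg mw.
have D0 z : 0 <= ((w z.1 - w z.2) ^+ 2 * rescaled g d z.1 z.2)%:E.
  exact: energy_density_ge0.
apply: (@le_trans _ _ (\int[mu]_(x in A) \int[mu]_y
   ((w x - w y) ^+ 2 * rescaled g d x y)%:E)).
  apply: ge0_le_integral => //.
  - by move=> x _; apply: integral_ge0 => y _; exact: (D0 (x, y)).
  - exact: (measurable_section_integral mA mB mD).
  - exact: (measurable_section_integral mA measurableT mD).
  - move=> x _; apply: ge0_subset_integral => //.
    + exact: (measurable_fun_pair2 x mD).
    + by move=> y _; exact: (D0 (x, y)).
apply: ge0_subset_integral => //.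
- exact: (measurable_section_integral measurableT measurableT mD).
- by move=> x _; apply: integral_ge0 => y _; exact: (D0 (x, y)).
Qed.

(** Each of the terms [2 * w x ^+ 2] and [2 * w y ^+ 2] contributes twice the kernel mass
    [d ^- 2 * \int g] times the integral of [w ^+ 2], whence the 4. *)
Lemma energy_le g (d : R) w A B : kernel_profile g -> (0 < d)%R ->
  measurable_fun setT w -> measurable A -> measurable B ->
  energy A B (rescaled g d) w <=
  (4 * d ^- 2)%:E * \int[mu]_s (g s)%:E * \int[mu]_x (w x ^+ 2)%:E.
Proof.
move=> hg d0 mw mA mB; apply: le_trans (energy_leT hg d0 mw mA mB) _.
have [g0 _ _ _] := hg.
have k0 x y : (0 <= rescaled g d x y)%R by exact: rescaled_ge0.
pose H (z : R * R) := (2 * w z.1 ^+ 2 * rescaled g d z.1 z.2)%:E.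
have mH : measurable_fun setT H.
  apply: (measurable_weighted_rescaled d hg (f := fun z => 2 * w z.1 ^+ 2)%R).
  apply: measurable_funM => //; apply: measurable_funX.
  exact: (measurableT_comp mw).
have mH' : measurable_fun setT (fun z => H (z.2, z.1)).
  exact: (measurableT_comp mH (@measurable_swap _ _ _ _)).
have H0 z : 0 <= H z.
  by rewrite lee_fin; apply: mulr_ge0 => //; rewrite mulr_ge0// sqr_ge0.
have mHH : measurable_fun setT (fun z => H z + H (z.2, z.1)).
  exact: emeasurable_funD.
have mD := measurable_energy_density d hg mw.
set W := \int[mu]_x (w x ^+ 2)%:E.
have [m m0 mE] : exists2 m, (0 <= m)%R & \int[mu]_s (g s)%:E = m%:E.
  exists (fine (\int[mu]_s (g s)%:E)); last first.
    by rewrite fineK//; exact: profile_integral_fin_num.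
  by apply: fine_ge0; apply: integral_ge0 => s _; rewrite lee_fin.
have HE : \int[mu]_x \int[mu]_y H (x, y) = (2 * d ^- 2 * m)%:E * W.
  rewrite -ge0_integralZl_EFin//; last 3 first.
  - by move=> x _; rewrite lee_fin sqr_ge0.
  - exact: measurable_sqr.
  - by rewrite !mulr_ge0// invr_ge0 sqr_ge0.
  apply: eq_integral => x _; rewrite /H/=.
  under eq_integral do rewrite EFinM.
  rewrite ge0_integralZl_EFin//; last 3 first.
  - by move=> y _; rewrite lee_fin.
  - apply/measurable_EFinP.
    exact: (measurable_fun_pair2 x (measurable_rescaled d hg)).
  - by rewrite mulr_ge0// sqr_ge0.
  rewrite integral_rescaled// mE -!EFinM; congr EFin; ring.
(* The term in [w y] is the term in [w x] with the variables exchanged, so Tonelli gives it the same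
   integral. *)
have HE' : \int[mu]_x \int[mu]_y H (y, x) = (2 * d ^- 2 * m)%:E * W.
  rewrite -HE.
  exact: (@tonelli_set _ _ _ (fun z => H (z.2, z.1)) measurableT measurableT).
rewrite mE -EFinM (_ : (4 * d ^- 2 * m = 2 * d ^- 2 * m + 2 * d ^- 2 * m)%R);
  last by ring.
have c0 : (0 <= 2 * d ^- 2 * m)%R by rewrite !mulr_ge0// invr_ge0 sqr_ge0.
rewrite EFinD ge0_muleDl ?lee_fin// -{1}HE -HE' -ge0_integralD//; last 4 first.
- by move=> x _; exact: integral_ge0.
- exact: (measurable_section_integral measurableT measurableT mH).
- by move=> x _; apply: integral_ge0 => y _; exact: (H0 (y, x)).
- exact: (measurable_section_integral measurableT measurableT mH').
apply: ge0_le_integral => //.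
- by move=> x _; apply: integral_ge0 => y _; exact: energy_density_ge0.
- apply: (measurable_section_integral measurableT measurableT mD) => z.
  exact: energy_density_ge0.
- apply: emeasurable_funD.
    exact: (measurable_section_integral measurableT measurableT mH).
  exact: (measurable_section_integral measurableT measurableT mH').
move=> x _; rewrite -ge0_integralD//; last 2 first.
- exact: (measurable_fun_pair2 x mH).
- exact: (measurable_fun_pair2 x mH').
apply: ge0_le_integral => //.
- by move=> y _; exact: energy_density_ge0.
- exact: (measurable_fun_pair2 x mD).
- exact: (measurable_fun_pair2 x mHH).
move=> y _; rewrite /H/= (rescaled_sym d y x hg) -EFinD lee_fin -mulrDl.
apply: ler_wpM2r => //; rewrite -subr_ge0.
rewrite (_ : _ - _ = (w x + w y) ^+ 2)%R; last by ring.
exact: sqr_ge0.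
Qed.

(** Common bounds [m] and [M] give all the energies in the norm, for either kernel and horizon, one
    and the same majorant. *)
Lemma energy_le_coarse g (d m M : R) w A B : kernel_profile g -> (0 < d)%R ->
  (d ^- 2 <= m ^+ 2)%R -> \int[mu]_s (g s)%:E <= M%:E ->
  measurable_fun setT w -> measurable A -> measurable B ->
  energy A B (rescaled g d) w <=
  (4 * m ^+ 2 * M)%:E * \int[mu]_x (w x ^+ 2)%:E.
Proof.
move=> hg d0 dm gM mw mA mB; apply: le_trans (energy_le hg d0 mw mA mB) _.
apply: lee_wpmul2r; first by apply: integral_ge0 => x _; rewrite lee_fin sqr_ge0.
rewrite (EFinM (4 * m ^+ 2)); apply: lee_pmul => //.
- by rewrite lee_fin mulr_ge0// invr_ge0 sqr_ge0.
- by apply: integral_ge0 => s _; rewrite lee_fin; case: hg.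
- by rewrite lee_fin ler_pM2l.
Qed.

Lemma poweR_half_scale (c : R) (x : \bar R) : (0 <= c)%R -> 0 <= x ->
  ((c ^+ 2)%:E * x) `^ 2^-1 = c%:E * x `^ 2^-1.
Proof.
move=> c0 x0; rewrite poweRM ?lee_fin ?sqr_ge0// poweR_EFin.
by rewrite powR12_sqrt ?sqr_ge0// sqrtr_sqr ger0_norm.
Qed.

Lemma le_poweR_half (x y : \bar R) : 0 <= x -> x <= y ->
  x `^ 2^-1 <= y `^ 2^-1.
Proof.
move=> x0 xy; apply: (@gt0_ler_poweR _ 2^-1%R) => //.
- by rewrite in_itv/= x0 leey.
- by rewrite in_itv/= (le_trans x0 xy) leey.
Qed.

Lemma integral_sqr_setU w (x y z : R) : measurable_fun setT w ->
  \int[mu]_(t in (`]x, y[ `|` `]y, z[)%classic) (w t ^+ 2)%:E =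
  \int[mu]_(t in `]x, y[) (w t ^+ 2)%:E + \int[mu]_(t in `]y, z[) (w t ^+ 2)%:E.
Proof.
move=> mw; rewrite ge0_integral_setU//.
- exact: measurable_sqr.
- by move=> t _; rewrite lee_fin sqr_ge0.
- apply/disj_setPLR => t /=; rewrite !in_itv/= => /andP[_ ty].
  by apply/negP; rewrite negb_and -leNgt ltW.
Qed.

Lemma L2normE A v :
  L2norm A v = (\int[mu]_x ((v \_ A) x ^+ 2)%:E) `^ 2^-1.
Proof.
rewrite /L2norm unlock; congr (_ `^ _); apply: eq_integral => x _ /=.
by rewrite powR_mulrn// real_normK ?num_real.
Qed.

(** A single point is null for the inner integral. Only [w] is assumed measurable; the integrand for
    [v] inherits measurability off [p] by agreeing there with the one for [w]. *)
Lemma eq_energy_off_point g (d p : R) v w A B : kernel_profile g -> (0 < d)%R ->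
  measurable_fun setT w -> measurable B ->
  (forall x, A x -> v x = w x) -> (forall y, B y -> y != p -> v y = w y) ->
  energy A B (rescaled g d) v = energy A B (rescaled g d) w.
Proof.
move=> hg d0 mw mB vwA vwB; apply: eq_integral => x /set_mem Ax.
have mD := measurable_fun_pair2 x (measurable_energy_density d hg mw).
have mDB : measurable_fun (B `\ p)
    (fun y => ((w x - w y) ^+ 2 * rescaled g d x y)%:E).
  by apply: measurable_funTS; exact: mD.
have mBp : measurable (B `\ p) by exact: measurableD.
have vw y : (B `\ p) y -> ((v x - v y) ^+ 2 * rescaled g d x y)%:E =
    ((w x - w y) ^+ 2 * rescaled g d x y)%:E.
  by move=> [By /eqP yp]; rewrite vwA// vwB.
rewrite -(@integral_setD1 _ _ p B)//; last first.
  by apply: eq_measurable_fun mDB => y /set_mem /vw.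
rewrite -[RHS](@integral_setD1 _ _ p B)//.
by apply: eq_integral => y /set_mem /vw.
Qed.

End upper_bound.

(** * Bounds on the horizons *)

Section geometry.
Set Implicit Arguments.
Unset Strict Implicit.
Context {R : realType}.

(** A longer horizon would put [b] in [I1J], hence in [Omega2], or [a] in [I2J], hence in [Omega1];
    these open intervals exclude their endpoints. *)
Lemma admissible_horizons (a b alpha d1 d2 : R) :
  admissible (Config a b alpha d1 d2) -> d1 <= b - alpha /\ d2 <= alpha - a.
Proof.
rewrite /admissible/=.
move=> [/andP[aal alb] /andP[d10 d12] sub2 sub1]; split; rewrite leNgt; apply/negP => h.
- have := sub1 b; rewrite /I1J /Omega2/= !in_itv/= => /(_ _)/andP[|_].
    by lra.
  by rewrite ltxx.
- have := sub2 a; rewrite /I2J /Omega1/= !in_itv/= => /(_ _)/andP[|].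
    by lra.
  by rewrite ltxx.
Qed.

End geometry.

(** * Combination of estimates in the extended reals *)

Section ereal_estimates.
Set Implicit Arguments.
Unset Strict Implicit.
Context {R : realType}.
Local Open Scope ereal_scope.
Implicit Types (W E F : \bar R).

(** The 8 is the 4 of the Poincaré bounds times the 2 that compensates the halves in front of the
    energies. Here [L] stands for a squared length. *)
Lemma combine_lower_bounds (s1 s2 L : R) W1 W2 E1 E2 F :
  (0 < s1)%R -> (0 < s2)%R -> (0 < L)%R ->
  0 <= W1 -> 0 <= W2 -> 0 <= E1 -> 0 <= E2 -> 0 <= F ->
  s1%:E * W1 <= (4 * L)%:E * E1 -> s2%:E * W2 <= (4 * L)%:E * E2 ->
  (Num.min s1 s2 / (8 * L))%:E * (W1 + W2) <=
  (2^-1)%:E * E1 + (2^-1)%:E * E2 + F.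
Proof.
move=> s10 s20 L0 W10 W20 E10 E20 F0 P1 P2.
have L40 : (0 <= 4 * L)%R by rewrite mulr_ge0// ltW.
rewrite mulrC EFinM -muleA lee_pdivrMl ?mulr_gt0//.
apply: (@le_trans _ _ ((4 * L)%:E * (E1 + E2))).
  rewrite ge0_muleDr// ge0_muleDr//; apply: leeD.
    apply: le_trans P1.
    by apply: lee_wpmul2r => //; rewrite lee_fin ge_min lexx.
  apply: le_trans P2.
  by apply: lee_wpmul2r => //; rewrite lee_fin ge_min lexx orbT.
rewrite (_ : (8 * L = 4 * L * 2)%R); last by ring.
rewrite (EFinM (4 * L) 2) -muleA; apply: lee_wpmul2l; rewrite ?lee_fin//.
have S0 : 0 <= (2^-1)%:E * (E1 + E2) by rewrite mule_ge0 ?lee_fin ?adde_ge0.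
rewrite -ge0_muleDr// [leRHS]ge0_muleDr//.
rewrite muleA -EFinM divff// mul1e leeDl//.
by rewrite mule_ge0 ?lee_fin.
Qed.

(** The weights of the five energies add up to 3. The case of infinite [T] is separate, since linear
    arithmetic only settles the finite one. *)
Lemma combine_upper_bounds T E1 E2 E3 E4 E5 : 0 <= T ->
  E1 <= T -> E2 <= T -> E3 <= T -> E4 <= T -> E5 <= T ->
  (2^-1)%:E * E1 + (2^-1)%:E * E2 + ((2^-1)%:E * (E3 + E4) + E5) <= 3%:E * T.
Proof.
move=> T0 le1 le2 le3 le4 le5.
have h0 : 0 <= (2^-1)%:E :> \bar R by rewrite lee_fin.
apply: (@le_trans _ _ ((2^-1)%:E * T + (2^-1)%:E * T +
    ((2^-1)%:E * (T + T) + T))).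
  apply: leeD; apply: leeD => //; apply: lee_wpmul2l => //.
  exact: leeD.
case: T T0 {le1 le2 le3 le4 le5} => [t| |]//= _; last first.
  by rewrite [leRHS]mulry gtr0_sg// mul1e leey.
by rewrite lee_fin; lra.
Qed.

End ereal_estimates.

Lemma sqr_inv_le_max (R : realType) (x y : R) : 0 < x -> 0 < y ->
  x ^- 2 <= Num.max x^-1 y^-1 ^+ 2 /\ y ^- 2 <= Num.max x^-1 y^-1 ^+ 2.
Proof.
move=> x0 y0; set m := Num.max _ _.
have le_sqr z : 0 < z -> z^-1 <= m -> z ^- 2 <= m ^+ 2.
  move=> z0 zm; have zV0 : 0 <= z^-1 by rewrite invr_ge0 ltW.
  by rewrite -exprVn lerXn2r// nnegrE (le_trans zV0).
by split; apply: le_sqr => //; rewrite le_max lexx ?orbT.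
Qed.

(** * Two-sided bounds for the squared norm *)

Section norm_bounds.
Set Implicit Arguments.
Unset Strict Implicit.
Context {R : realType}.
Local Notation mu := (@lebesgue_measure R).
Local Open Scope ereal_scope.

Variables (a b alpha d1 d2 : R) (g1 g2 : R -> R).
Let G := Config a b alpha d1 d2.
Hypotheses (hg1 : kernel_profile g1) (hg2 : kernel_profile g2)
  (hG : admissible G).
Variable v : R -> R.
Hypothesis hv : V0 G v.

(** Membership in [V0] leaves [v] arbitrary at [a], [alpha], [b] and far away. The function [w] is
    measurable on the whole line and vanishes beyond both ends, as the Poincaré inequalities
    require. *)
Let w := v \_ (Omega1 G `|` Omega2 G).
Let W := \int[mu]_x (w x ^+ 2)%:E.

Let d1_gt0 : (0 < d1)%R.
Proof. by case: hG => _ /andP[]. Qed.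

Let d2_gt0 : (0 < d2)%R.
Proof. by case: hG => _ /andP[/= d10 d12] _ _; exact: lt_le_trans d12. Qed.

Let mw : measurable_fun setT w.
Proof. by case: hv => /sub_Lfun_mfun; rewrite inE. Qed.

Let W_ge0 : 0 <= W.
Proof. by apply: integral_ge0 => x _; rewrite lee_fin sqr_ge0. Qed.

Let w_Omega x : (Omega1 G `|` Omega2 G) x -> v x = w x.
Proof. by move=> Ox; rewrite /w patchE mem_set. Qed.

Let w_off x : ~ (Omega1 G `|` Omega2 G) x -> w x = 0%R.
Proof. by move=> Ox; rewrite /w patchE memNset. Qed.

Let w_le_a x : (x <= a)%R -> w x = 0%R.
Proof.
case: hG => /andP[/= aal _] _ _ _ xa; apply: w_off.
by rewrite /Omega1 /Omega2/= !in_itv/= => -[]; lra.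
Qed.

Let w_ge_b x : (b <= x)%R -> w x = 0%R.
Proof.
case: hG => /andP[/= aal alb] _ _ _ xa; apply: w_off.
by rewrite /Omega1 /Omega2/= !in_itv/= => -[]; lra.
Qed.

Let w_I1D x : I1D G x -> v x = w x.
Proof.
case: hv => _ v1 _ xI; rewrite v1// w_le_a//.
by move: xI; rewrite /I1D/= in_itv/= => /andP[_ /ltW].
Qed.

Let w_I2D x : I2D G x -> v x = w x.
Proof.
case: hv => _ _ v2 xI; rewrite v2// w_ge_b//.
by move: xI; rewrite /I2D/= in_itv/= => /andP[/ltW].
Qed.

(** [Omega2J] may reach past [b]: its points left of [b] lie in [Omega2], and those right of [b] lie
    in [I2D] because [alpha + d2 < b + d2]. *)
Let w_Omega2J x : Omega2J G x -> x != b -> v x = w x.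
Proof.
case: hG => /andP[/= aal alb] _ _ _.
rewrite /Omega2J/= in_itv/= => /andP[x1 x2]; rewrite neq_lt => /orP[xb|bx].
  by apply: w_Omega; right; rewrite /Omega2/= in_itv/=; move: d1_gt0; lra.
by apply: w_I2D; rewrite /I2D/= in_itv/=; lra.
Qed.

(* [V0] says nothing about [v b], and [Omega2J] contains [b] when
   [b < alpha + d2]. *)
Let eq_energy g d A B : kernel_profile g -> (0 < d)%R -> measurable B ->
  (forall x, A x -> v x = w x) -> (forall x, B x -> x != b -> v x = w x) ->
  energy A B (rescaled g d) v = energy A B (rescaled g d) w.
Proof. by move=> hg d0 mB vwA vwB; exact: (eq_energy_off_point (p := b)). Qed.

Let A1 : set R := Omega1 G `|` I1D G.
Let A2 : set R := Omega2 G `|` I2D G.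

Let vw_A1 x : A1 x -> v x = w x.
Proof. by case=> [x1|/w_I1D//]; apply: w_Omega; left. Qed.

Let vw_A2 x : A2 x -> v x = w x.
Proof. by case=> [x2|/w_I2D//]; apply: w_Omega; right. Qed.

Let vw_I1J x : I1J G x -> v x = w x.
Proof. by case: hG => _ _ _ sub /sub x2; apply: w_Omega; right. Qed.

Let vw_I2J x : I2J G x -> v x = w x.
Proof. by case: hG => _ _ sub _ /sub x1; apply: w_Omega; left. Qed.

Let measurable_pieces : [/\ measurable A1, measurable A2,
  measurable (I1J G), measurable (I2J G) & measurable (Omega2J G)].
Proof. by split; (try apply: measurableU); exact: measurable_itv. Qed.

Let sqnorm1E : sqnorm1 g1 G v = (2^-1)%:E * energy A1 A1 (rescaled g1 d1) w.
Proof.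
have [mA1 _ _ _ _] := measurable_pieces.
by rewrite /sqnorm1 -/A1
  (eq_energy hg1 d1_gt0 mA1 vw_A1 (fun x xA _ => vw_A1 xA)).
Qed.

Let sqnorm2E : sqnorm2 g2 G v = (2^-1)%:E * energy A2 A2 (rescaled g2 d2) w.
Proof.
have [_ mA2 _ _ _] := measurable_pieces.
by rewrite /sqnorm2 -/A2
  (eq_energy hg2 d2_gt0 mA2 vw_A2 (fun x xA _ => vw_A2 xA)).
Qed.

Let sqnormGammaE : sqnormGamma g1 g2 G v =
  (2^-1)%:E * (energy (I2J G) (I1J G) (rescaled g1 d1) w
             + energy (I1J G) (I2J G) (rescaled g2 d2) w)
  + energy (I2J G) (Omega2J G) (rescaled g2 d2) w.
Proof.
have [_ _ mI1J mI2J mO2J] := measurable_pieces.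
by rewrite /sqnormGamma
  (eq_energy hg1 d1_gt0 mI1J vw_I2J (fun x xI _ => vw_I1J xI))
  (eq_energy hg2 d2_gt0 mI2J vw_I1J (fun x xI _ => vw_I2J xI))
  (eq_energy hg2 d2_gt0 mO2J vw_I2J w_Omega2J).
Qed.

Let energy_ge0 g d A B : kernel_profile g -> (0 < d)%R ->
  0 <= energy A B (rescaled g d) w.
Proof.
move=> hg d0; apply: integral_ge0 => x _; apply: integral_ge0 => y _.
exact: energy_density_ge0.
Qed.

Let sqnormGamma_ge0 : 0 <= sqnormGamma g1 g2 G v.
Proof.
rewrite sqnormGammaE; apply: adde_ge0; last exact: (energy_ge0 _ _ hg2 d2_gt0).
apply: mule_ge0; first by rewrite lee_fin.
by apply: adde_ge0;
  [exact: (energy_ge0 _ _ hg1 d1_gt0)|exact: (energy_ge0 _ _ hg2 d2_gt0)].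
Qed.

Let sqnorm_total :=
  sqnorm1 g1 G v + sqnorm2 g2 G v + sqnormGamma g1 g2 G v.

Lemma sqnorm_total_ge (sigma1 sigma2 : R) : (0 < sigma1)%R -> (0 < sigma2)%R ->
  half_second_moment g1 = sigma1%:E -> half_second_moment g2 = sigma2%:E ->
  (Num.min sigma1 sigma2 / (8 * (b - a) ^+ 2))%:E * W <= sqnorm_total.
Proof.
move=> s10 s20 hs1 hs2.
have [hd1 hd2] := admissible_horizons hG.
have [/andP[/= aal alb] _ _ _] := hG.
have d1L : (0 < d1 <= b - a)%R by rewrite d1_gt0; lra.
have d2L : (0 < d2 <= b - a)%R by rewrite d2_gt0; lra.
(* Each half is estimated from its outer end, where [w] vanishes. The length [b - a] dominates both
   halves and both horizons, so the constant depends on neither [alpha] nor the horizons. *)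
have P1 := poincare_left hg1 hs1 d1L (_ : alpha - a <= b - a)%R mw w_le_a.
have P2 := poincare_right hg2 hs2 d2L (_ : b - alpha <= b - a)%R mw w_ge_b.
set E1 := energy _ _ _ _ in P1; set E2 := energy _ _ _ _ in P2.
set W1 := integral _ _ _ in P1; set W2 := integral _ _ _ in P2.
have WE : W = W1 + W2.
  rewrite /W (@ge0_integral_setTE _ (Omega1 G `|` Omega2 G)).
    exact: integral_sqr_setU.
  by move=> x /w_off ->; rewrite expr0n.
rewrite /sqnorm_total sqnorm1E sqnorm2E WE; apply: combine_lower_bounds.
- exact: s10.
- exact: s20.
- apply: exprn_gt0; rewrite subr_gt0; exact: lt_trans alb.
- by apply: integral_ge0 => x _; rewrite lee_fin sqr_ge0.
- by apply: integral_ge0 => x _; rewrite lee_fin sqr_ge0.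
- exact: (energy_ge0 _ _ hg1 d1_gt0).
- exact: (energy_ge0 _ _ hg2 d2_gt0).
- exact: sqnormGamma_ge0.
- by apply: P1; rewrite lerD2r ltW.
- by apply: P2; rewrite lerD2l lerN2 ltW.
Qed.

Lemma sqnorm_total_le (M : R) :
  \int[mu]_s (g1 s)%:E <= M%:E -> \int[mu]_s (g2 s)%:E <= M%:E ->
  sqnorm_total <= (12 * M * Num.max d1^-1 d2^-1 ^+ 2)%:E * W.
Proof.
move=> M1 M2; have [mA1 mA2 mI1J mI2J mO2J] := measurable_pieces.
set m := Num.max _ _.
have [m1 m2] := sqr_inv_le_max d1_gt0 d2_gt0.
pose T := (4 * m ^+ 2 * M)%:E * W.
have T0 : 0 <= T.
  apply: mule_ge0; last exact: W_ge0.
  rewrite lee_fin; apply: mulr_ge0; first exact: (mulr_ge0 (ler0n _ 4) (sqr_ge0 _)).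
  rewrite -lee_fin; apply: le_trans M1; apply: integral_ge0 => s _.
  by case: hg1 => g0 _ _ _; rewrite lee_fin; exact: g0.
(* The 3 is the total weight of the five energies, the 4 comes from [energy_le]. *)
rewrite (_ : (12 * M * m ^+ 2 = 3 * (4 * m ^+ 2 * M))%R); last by ring.
rewrite (EFinM 3) -muleA -/T.
rewrite /sqnorm_total sqnorm1E sqnorm2E sqnormGammaE.
apply: combine_upper_bounds; first exact: T0.
- exact: (energy_le_coarse hg1 d1_gt0 m1 M1 mw mA1 mA1).
- exact: (energy_le_coarse hg2 d2_gt0 m2 M2 mw mA2 mA2).
- exact: (energy_le_coarse hg1 d1_gt0 m1 M1 mw mI2J mI1J).
- exact: (energy_le_coarse hg2 d2_gt0 m2 M2 mw mI1J mI2J).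
- exact: (energy_le_coarse hg2 d2_gt0 m2 M2 mw mI2J mO2J).
Qed.

End norm_bounds.

(** * Choice of the constants and passage from squared norms to norms *)

Theorem lemma3p2 (R : realType) (a b : R) (hab : a < b)
    (g1 g2 : R -> R) (hg1 : kernel_profile g1) (hg2 : kernel_profile g2)
    (sigma1 sigma2 : R) (hsigma1 : 0 < sigma1) (hsigma2 : 0 < sigma2)
    (hmoment1 : half_second_moment g1 = sigma1%:E)
    (hmoment2 : half_second_moment g2 = sigma2%:E) :
  exists C1 C2 : R, [/\ 0 < C1, 0 < C2 &
    forall alpha : R, kernel_mass_bound g1 g2 a b alpha ->
    forall d1 d2 : R,
      let G := Config a b alpha d1 d2 in
      admissible G ->
      forall v : R -> R, V0 G v ->
        (C1%:E * L2norm (Omega1 G `|` Omega2 G) v <= delta_norm g1 g2 G v)%E /\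
        (delta_norm g1 g2 G v <=
           (C2 * Num.max d1^-1 d2^-1)%:E
             * L2norm (Omega1 G `|` Omega2 G) v)%E].
Proof.
pose m g : R := fine (\int[@lebesgue_measure R]_s (g s)%:E)%E.
have m0 g : kernel_profile g -> 0 <= m g.
  by case=> g0 _ _ _; apply: fine_ge0; apply: integral_ge0 => s _; rewrite lee_fin.
have m10 := m0 _ hg1; have m20 := m0 _ hg2.
have mE g : kernel_profile g ->
    (\int[@lebesgue_measure R]_s (g s)%:E = (m g)%:E)%E.
  by move=> hg; rewrite fineK//; exact: profile_integral_fin_num.
pose c := Num.min sigma1 sigma2 / (8 * (b - a) ^+ 2).
(* The sum bounds both kernel masses at once, and the added 1 makes [M] positive at no cost. *)
pose M := m g1 + m g2 + 1.
have M0 : 0 < M by rewrite ltr_wpDl// addr_ge0.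
have c0 : 0 < c.
  rewrite divr_gt0 ?lt_min ?hsigma1 ?hsigma2// mulr_gt0// exprn_gt0//.
  by rewrite subr_gt0.
(* The estimates concern squared norms, hence the square roots; [c] and [M] involve only [b - a] and
   the profiles, through their moments and masses. *)
exists (Num.sqrt c), (Num.sqrt (12 * M)); split.
- by rewrite sqrtr_gt0.
- by rewrite sqrtr_gt0 mulr_gt0.
move=> alpha _ d1 d2 G hG v hv.
have W0 : (0 <= \int[@lebesgue_measure R]_x
    ((v \_ (Omega1 G `|` Omega2 G)) x ^+ 2)%:E)%E.
  by apply: integral_ge0 => x _; rewrite lee_fin sqr_ge0.
have d10 : 0 < d1 by case: hG => _ /andP[].
have mx0 : 0 <= Num.max d1^-1 d2^-1 by rewrite le_max invr_ge0 ltW.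
have lb := sqnorm_total_ge hg1 hg2 hG hv hsigma1 hsigma2 hmoment1 hmoment2.
have ub : (_ <= _)%E := sqnorm_total_le hg1 hg2 hG hv (M := M) _ _.
rewrite L2normE /delta_norm; split.
- rewrite -poweR_half_scale ?sqrtr_ge0// sqr_sqrtr ?(ltW c0)//.
  by apply: (le_poweR_half _ lb); rewrite mule_ge0// lee_fin ltW.
- rewrite -poweR_half_scale ?mulr_ge0 ?sqrtr_ge0//.
  rewrite exprMn sqr_sqrtr ?(mulr_ge0 _ (ltW M0))//.
  apply: le_poweR_half.
    by apply: le_trans lb; rewrite mule_ge0// lee_fin ltW.
  by apply: ub; rewrite mE// lee_fin /M; lra.
Qed.
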